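(* Let $t\ge2$, let $L,R$ be disjoint sets of $2t$ coordinates each, with prescribed perfect matchings $M_L$ of $L$ and $M_R$ of $R$, and put $E_L=\binom L2\setminus M_L$, $E_R=\binom R2\setminus M_R$. Let $\mathcal{A}\subseteq E_L\times E_R$, where $(e,f)$ is identified with the four-element support $e\cup f$. Let $Q$ be the set of vectors obtained by taking all sixteen $\pm1$ sign patterns on each support in $\mathcal{A}$ and applying the paired Hadamard map. Then $Q$ is an internally compatible weight-eight code if and only if both $$\{f:(e,f)\in\mathcal{A}\}\ \ (e\in E_L)\qquad\text{and}\qquad\{e:(e,f)\in\mathcal{A}\}\ \ (f\in E_R)$$ are always matchings on their respective coordinate sets. Consequently, for such $\mathcal{A}$, $$|\mathcal{A}|\le2t^2(t-1),\qquad|Q|\le32t^2(t-1).$$ Equality holds precisely when every one of these left and right fibres is a perfect matching. For any prescribed $M_L,M_R$, equality is attainable. In particular, $t=3$ gives $576$ vectors in twelve coordinates.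
   Context: A matching is a set of pairwise disjoint two-element subsets (edges); it is perfect if it covers all coordinates of the set in question. A weight-eight code here is a set of vectors in $\{0,\pm1\}^{L\cup R}$ each with exactly eight nonzero coordinates; it is internally compatible if any two distinct vectors have inner product at most $4$. The paired Hadamard map is the linear map on $\mathbb{R}^{L\cup R}$ that applies the matrix $\begin{pmatrix}1&1\\1&-1\end{pmatrix}$ to the two coordinates of each pair of $M_L\cup M_R$. A sign pattern on a support $S$ is a vector with entries $\pm1$ on $S$ and $0$ elsewhere. *)

(* Defs.v *)
From HB Require Import structures.
From mathcomp Require Import all_boot all_order all_algebra.
From mathcomp Require Import classical_sets cardinality reals.

Set Implicit Arguments.
Unset Strict Implicit.
Unset Printing Implicit Defensive.

Import Order.TTheory GRing.Theory Num.Theory.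
Local Open Scope ring_scope.

Definition edges (T : finType) : {set {set T}} := [set e : {set T} | #|e| == 2]%SET.

Definition matching (T : finType) (N : {set {set T}}) : bool :=
  (N \subset edges T) && finset.trivIset N.

Definition perfect_matching (T : finType) (N : {set {set T}}) : bool :=
  matching N && (finset.cover N == [set: T]%SET).

Definition dotp (K : realType) (T : finType) (x y : {ffun T -> K}) : K :=
  \sum_i x i * y i.

Definition weight_eight_code (K : realType) (T : finType)
    (C : set {ffun T -> K}) : Prop :=
  forall x, C x ->
    (forall i, [\/ x i = 0, x i = 1 | x i = -1]) /\
    #|[set i | x i != 0]%SET| = 8%N.

Definition internally_compatible (K : realType) (T : finType)
    (C : set {ffun T -> K}) : Prop :=
  forall x y, C x -> C y -> x <> y -> dotp x y <= 4.

Definition sign_pattern (K : realType) (T : finType) (S : {set T})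
    (x : {ffun T -> K}) : Prop :=
  forall i, if i \in S then x i = 1 \/ x i = -1 else x i = 0.

(* The matrix (1 1; 1 -1) is not invariant under swapping the two coordinates
   of a pair, so each pair has to be ordered: F is the set of all first
   coordinates. *)
Definition first_coordinates (T : finType) (M : {set {set T}})
    (F : {set T}) : Prop :=
  forall p, p \in M -> #|p :&: F| = 1%N.

(* For i and j in a common pair, the coefficient is the (i, j) entry of
   (1 1; 1 -1), which is -1 exactly when i and j are both second. *)
Definition paired_hadamard (K : realType) (T : finType) (M : {set {set T}})
    (F : {set T}) (x : {ffun T -> K}) : {ffun T -> K} :=
  [ffun i => \sum_(j | [exists p in M, (i \in p) && (j \in p)])
               (if (i \in F) || (j \in F) then 1 else -1) * x j].

(* The disjoint union of the coordinate sets L and R is the sum type L + R. *)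
Definition coord_pairs (L R : finType) (ML : {set {set L}})
    (MR : {set {set R}}) : {set {set (L + R)%type}} :=
  ([set inl @: e | e : {set L} in ML] :|: [set inr @: f | f : {set R} in MR])%SET.

Definition support_of (L R : finType) (a : {set L} * {set R}) :
    {set (L + R)%type} :=
  (inl @: a.1 :|: inr @: a.2)%SET.

Definition hadamard_code (K : realType) (L R : finType) (ML : {set {set L}})
    (MR : {set {set R}}) (F : {set (L + R)%type})
    (A : {set {set L} * {set R}}) : set {ffun (L + R)%type -> K} :=
  [set paired_hadamard (coord_pairs ML MR) F x | x in
    [set x | exists2 a, a \in A & sign_pattern (support_of a) x]]%classic.

Definition right_fibre (L R : finType) (A : {set {set L} * {set R}})
    (e : {set L}) : {set {set R}} := [set f | (e, f) \in A]%SET.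

Definition left_fibre (L R : finType) (A : {set {set L} * {set R}})
    (f : {set R}) : {set {set L}} := [set e | (e, f) \in A]%SET.

Definition fibres_matchings (L R : finType) (EL : {set {set L}})
    (ER : {set {set R}}) (A : {set {set L} * {set R}}) : Prop :=
  (forall e, e \in EL -> matching (right_fibre A e)) /\
  (forall f, f \in ER -> matching (left_fibre A f)).

Definition fibres_perfect_matchings (L R : finType) (EL : {set {set L}})
    (ER : {set {set R}}) (A : {set {set L} * {set R}}) : Prop :=
  (forall e, e \in EL -> perfect_matching (right_fibre A e)) /\
  (forall f, f \in ER -> perfect_matching (left_fibre A f)).

(* Main.v *)
(* Write sigma for the partner map of the pairing.  The paired Hadamard map is
   x |-> (+-x_i + x_(sigma i))_i with opposite signs at i and sigma i, hence it
   doubles inner products.  As no support e :|: f contains a pair, the images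
   have weight eight, and compatibility says that inner products of distinct
   sign patterns are at most 2.  On one support this is automatic; on two
   supports the largest inner product is the size of their intersection, which
   exceeds 2 exactly when the supports share one edge and their other edges
   meet, i.e. when some fibre is not a matching.  Summing fibre sizes (at most t)
   over the 2t(t - 1) edges gives the bound, and joining equally coloured edges
   of one-factorizations of K_2t in which the prescribed matchings are colour
   classes attains it. *)

Require Import Defs.
From HB Require Import structures.
From mathcomp Require Import all_boot all_order all_algebra.
From mathcomp Require Import classical_sets cardinality reals.
From mathcomp Require Import zify ring lra.

Set Implicit Arguments.
Unset Strict Implicit.
Unset Printing Implicit Defensive.

Import Order.TTheory GRing.Theory Num.Theory.
(* Restores the finite-set names that classical_sets shadows. *)
Import boot.fintype boot.finset.

(** * Matchings and edges of a finite coordinate set *)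

Section Matchings.
Variable T : finType.
Implicit Types (N : {set {set T}}) (e : {set T}).

Lemma matchingP N :
  reflect (N \subset edges T /\
           forall e e' x, e \in N -> e' \in N -> x \in e -> x \in e' -> e = e')
          (matching N).
Proof.
apply: (iffP andP) => -[sN tN]; split=> //.
  move=> e e' x eN e'N xe xe'.
  by rewrite -(def_pblock tN eN xe) (def_pblock tN e'N xe').
apply/trivIsetP => e e' eN e'N; apply: contraNT => /pred0Pn[x /andP[xe xe']].
exact/eqP/(tN e e' x).
Qed.

Lemma matching_card_cover N : matching N -> #|cover N| = (2 * #|N|)%N.
Proof.
case/andP=> /subsetP sN /eqP <-; rewrite mulnC -sum_nat_const.
by apply: eq_bigr => e /sN; rewrite inE => /eqP.
Qed.

(** The edges of [N] cover [2 * #|N|] of the [2 * t] points, and all of them exactly when [N] is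
    perfect. The [leqif] form carries the equality case through sums over fibres. *)
Lemma matching_leqif (t : nat) N : #|T| = (2 * t)%N -> matching N ->
  (#|N| <= t ?= iff perfect_matching N)%N.
Proof.
move=> cT mN; have cN := matching_card_cover mN.
have := max_card (mem (cover N)); rewrite cN cT leq_pmul2l // => leN.
split=> //; rewrite /perfect_matching mN /= eqEcard subsetT /= cardsT cT cN.
by rewrite leq_pmul2l // eqn_leq leN.
Qed.

Lemma perfect_matching_card (t : nat) N : #|T| = (2 * t)%N ->
  perfect_matching N -> #|N| = t.
Proof.
move=> cT pN; have /andP[mN _] := pN.
by apply/eqP; rewrite (matching_leqif cT mN).
Qed.

Lemma perfect_matchingP N x : perfect_matching N ->
  exists2 y, y != x & [set x; y] \in N.
Proof.
case/andP=> /andP[/subsetP sN _] /eqP cN.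
have /bigcupP[e eN xe] : x \in cover N by rewrite cN inE.
have := sN _ eN; rewrite inE => /cards2P[a [b [ab ee]]]; move: xe eN.
rewrite ee !inE => /orP[]/eqP-> eN; first by exists b; rewrite // eq_sym.
by exists a; rewrite // setUC.
Qed.

Lemma card_edges_perfect_matching (t : nat) N : #|T| = (2 * t)%N ->
  perfect_matching N -> #|edges T :\: N| = (2 * t * (t - 1))%N.
Proof.
move=> cT pN; have /andP[/andP[sN _] _] := pN.
rewrite cardsD (setIidPr sN) (perfect_matching_card cT pN).
rewrite /edges card_draws cT bin2; case: t {cT} => // t; nia.
Qed.

Lemma edges_meet e e' :
  e \in edges T -> e' \in edges T -> e != e' -> (#|e :&: e'| <= 1)%N.
Proof.
rewrite !inE => /eqP ce /eqP ce'; apply: contraNT; rewrite -ltnNge => c2.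
have E : e :&: e' = e by apply/eqP; rewrite eqEcard subsetIl ce.
by rewrite eqEcard ce ce' leqnn andbT -E subsetIr.
Qed.

End Matchings.

(** * Counting a set of supports through its fibres *)

Section Fibres.
Variables (L R : finType) (EL : {set {set L}}) (ER : {set {set R}}).
Implicit Type A : {set {set L} * {set R}}.

Lemma card_sum_right_fibres A : A \subset setX EL ER ->
  #|A| = (\sum_(e in EL) #|right_fibre A e|)%N.
Proof.
move=> /subsetP sA; rewrite -sum1_card (partition_big fst (mem EL)) /=; last first.
  by case=> e f /sA; rewrite inE => /andP[].
apply: eq_bigr => e _; rewrite -sum1_card.
rewrite (reindex_onto (fun f => (e, f)) snd) /=; last first.
  by case=> a b /andP[_ /eqP /= ->].
by apply: eq_bigl => f; rewrite inE !eqxx !andbT.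
Qed.

Lemma card_sum_left_fibres A : A \subset setX EL ER ->
  #|A| = (\sum_(f in ER) #|left_fibre A f|)%N.
Proof.
move=> /subsetP sA; rewrite -sum1_card (partition_big snd (mem ER)) /=; last first.
  by case=> e f /sA; rewrite inE => /andP[].
apply: eq_bigr => f _; rewrite -sum1_card.
rewrite (reindex_onto (fun e => (e, f)) fst) /=; last first.
  by case=> a b /andP[_ /eqP /= ->].
by apply: eq_bigl => e; rewrite inE !eqxx !andbT.
Qed.

(** [#|A|] is the sum of the right fibre sizes and also of the left ones, with terms at most [t].
    Reaching the bound makes every term of both sums tight. *)
Lemma fibres_matchings_card (t : nat) A :
  #|L| = (2 * t)%N -> #|R| = (2 * t)%N ->
  #|EL| = (2 * t * (t - 1))%N -> #|ER| = (2 * t * (t - 1))%N ->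
  A \subset setX EL ER -> fibres_matchings EL ER A ->
  (#|A| <= 2 * t ^ 2 * (t - 1))%N /\
  (#|A| = (2 * t ^ 2 * (t - 1))%N <-> fibres_perfect_matchings EL ER A).
Proof.
move=> cL cR cEL cER sA [mR mL].
have := leqif_sum (fun e eE => matching_leqif cR (mR e eE)).
have := leqif_sum (fun f fE => matching_leqif cL (mL f fE)).
rewrite -card_sum_left_fibres // -card_sum_right_fibres //.
rewrite !sum_nat_const cEL cER.
have -> : (2 * t * (t - 1) * t = 2 * t ^ 2 * (t - 1))%N by lia.
move=> lefL lefR; split; first by case: lefL.
split=> [cA|[pR _]]; last first.
  by apply/eqP; rewrite lefR; apply/forall_inP => e /pR.
by split; apply/forall_inP; rewrite -?(lefL.2) -?(lefR.2) cA.
Qed.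

End Fibres.

(** * One-factorizations with a prescribed colour class *)

Section OneFactorization.
Variable T : finType.
Implicit Types (N : {set {set T}}) (e : {set T}).

(** The [k]-th pair, counting from 0, receives the labels [k] and [2 * t - 1 - k]. As [k < t], the
    two label ranges are disjoint; the constant label sum later puts all prescribed pairs into one
    colour class. *)
Lemma perfect_matching_labelling (t : nat) N :
    #|T| = (2 * t)%N -> perfect_matching N ->
  exists phi : T -> nat, [/\ injective phi, forall x, (phi x < 2 * t)%N &
    forall x y, x != y -> [set x; y] \in N -> (phi x + phi y = (2 * t).-1)%N].
Proof.
move=> cT pN; have cN := perfect_matching_card cT pN.
have /andP[/andP[/subsetP sN tN] /eqP coverN] := pN.
have inB x : x \in pblock N x by rewrite mem_pblock coverN inE.
have BN x : pblock N x \in N by rewrite pblock_mem // coverN inE.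
pose idx x := index (pblock N x) (enum N).
have idx_lt x : (idx x < t)%N by rewrite -cN cardE index_mem mem_enum.
have idx_inj x y : idx x = idx y -> pblock N x = pblock N y.
  move=> /(congr1 (nth set0 (enum N))).
  by rewrite !nth_index // mem_enum.
pose fst_of e := [pick y in e].
exists (fun x => if fst_of (pblock N x) == Some x then idx x
                 else (2 * t).-1 - idx x)%N; split.
- move=> x y; have := idx_lt x; have := idx_lt y.
  case: eqP => [fx|fx]; case: eqP => [fy|fy] ty tx E; try lia.
    by have Exy := idx_inj _ _ E; move: fx; rewrite Exy fy => -[].
  have Exy : pblock N x = pblock N y by apply: idx_inj; lia.
  move: fx fy (inB x) (inB y) (sN _ (BN x)); rewrite Exy inE /fst_of.
  case: pickP => [z zB fx fy xB yB|/(_ y) -> //] /cards2P[a [b [ab Eab]]].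
  move: zB xB yB fx fy; rewrite Eab !inE.
  by do 3![case/orP => /eqP->].
- by move=> x; have := idx_lt x; case: eqP; lia.
move=> x y xy exy.
have Bx := def_pblock tN exy (set21 x y); have By := def_pblock tN exy (set22 x y).
have Eidx : idx y = idx x by rewrite /idx Bx By.
have := idx_lt x; rewrite Eidx Bx By /fst_of.
case: pickP => [z|/(_ x)]; rewrite !inE; last by rewrite eqxx.
have yx : (Some y == Some x) = false by apply/negbTE; rewrite eq_sym in xy.
case/orP=> /eqP-> tx; first by rewrite eqxx ifN //; lia.
by rewrite yx eqxx; lia.
Qed.

(** Two is invertible modulo an odd [n]. This separates the colours of the pairs through
    infinity. *)
Lemma double_mod_inj (n a b : nat) : odd n -> (a < n)%N -> (b < n)%N ->
  (2 * a = 2 * b %[mod n])%N -> a = b.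
Proof.
move=> odd_n; wlog ab : a b / (b <= a)%N.
  by move=> H an bn E; case: (leqP b a) => [|/ltnW] le; [|symmetry]; apply: H.
move=> an bn /eqP; rewrite eqn_mod_dvd ?leq_pmul2l // -mulnBr.
rewrite Gauss_dvdr ?coprimen2 // => /dvdnP[[|k]]; nia.
Qed.

(* The round-robin schedule: 2t teams are labelled 0, ..., 2t - 1, the last
   label plays the role of infinity, and the pair {x, y} gets the colour
   x + y mod 2t - 1, or 2x if y is infinity.  Pairs with label sum 2t - 1 form
   the colour class 0. *)
Lemma one_factorization (t : nat) N :
    (0 < t)%N -> #|T| = (2 * t)%N -> perfect_matching N ->
  exists col : {set T} -> nat,
    [/\ forall e e' x, e \in edges T -> e' \in edges T -> x \in e -> x \in e' ->
          col e = col e' -> e = e',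
        forall e, e \in edges T -> (col e == 0)%N = (e \in N),
        forall e, (col e < (2 * t).-1)%N &
        forall x c, (c < (2 * t).-1)%N ->
          exists e, [/\ e \in edges T, x \in e & col e = c]].
Proof.
move=> t0 cT pN; have [phi [phi_inj phi_lt phi_sum]] :=
  perfect_matching_labelling cT pN.
set n := (2 * t).-1; have n0 : (0 < n)%N by lia.
have odd_n : odd n by rewrite /n; lia.
(* Here [n] is both the modulus and the label of infinity. As [n] vanishes modulo [n], doubling the
   whole label sum of an edge leaves twice its finite label. *)
pose col e := if [exists x in e, phi x == n] then (2 * \sum_(x in e) phi x) %% n
              else (\sum_(x in e) phi x) %% n.
have colE x y : x != y -> col [set x; y] =
    if (phi x == n) || (phi y == n) then (2 * (phi x + phi y)) %% n
    else (phi x + phi y) %% n.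
  move=> xy; rewrite /col big_setU1 ?big_set1 ?inE //=; congr (if _ then _ else _).
  apply/exists_inP/orP => [[z]|[] E]; last 2 first.
  - by exists x; rewrite ?inE ?eqxx.
  - by exists y; rewrite ?inE ?eqxx ?orbT.
  by rewrite !inE => /orP[]/eqP->; [left|right].
have edgeP e x : e \in edges T -> x \in e -> exists2 y, x != y & e = [set x; y].
  rewrite inE => /cards2P[a [b [ab ->]]]; rewrite !inE => /orP[]/eqP->.
    by exists b.
  by exists a; rewrite 1?eq_sym // setUC.
have phi_le x : phi x != n -> (phi x < n)%N.
  by have := phi_lt x; rewrite /n; lia.
have col_inj x y z : x != y -> x != z -> col [set x; y] = col [set x; z] -> y = z.
  move=> xy xz; rewrite !colE //.
  have phi_ne u v : u != v -> phi u = n -> phi v != n.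
    by move=> uv pu; apply: contraNneq uv => pv; apply/eqP/phi_inj; rewrite pu pv.
  (* Equal colours of an infinite and a finite pair at [x] would give [2 * phi x = phi x + phi v]
     modulo [n], hence [v = x]. *)
  have aux u v : x != v -> phi x != n -> phi u = n -> phi v != n ->
      (2 * (phi x + phi u)) %% n = (phi x + phi v) %% n -> False.
    move=> xv px pu pv; rewrite pu => /eqP.
    have -> : (2 * (phi x + n) = phi x + (2 * n + phi x))%N by lia.
    rewrite eqn_modDl modnMDl !modn_small ?phi_le // => /eqP/phi_inj E.
    by rewrite E eqxx in xv.
  case: (eqVneq (phi x) n) => [px|px] /=.
    move=> E; apply/phi_inj/(@double_mod_inj n); rewrite ?phi_le ?(phi_ne x) //.
    by move: E; rewrite px !mulnDr !modnMDl.
  case: (eqVneq (phi y) n) => py; case: (eqVneq (phi z) n) => pz E.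
  - by apply: phi_inj; rewrite py pz.
  - by case: (aux y z).
  - by case: (aux z y).
  - by move/eqP: E; rewrite eqn_modDl !modn_small ?phi_le // => /eqP/phi_inj.
have col_lt e : (col e < n)%N by rewrite /col; case: ifP; rewrite ltn_mod.
have proper e e' x : e \in edges T -> e' \in edges T -> x \in e -> x \in e' ->
    col e = col e' -> e = e'.
  move=> /edgeP eE /edgeP e'E /eE[y xy ->] /e'E[z xz ->].
  by move=> /(col_inj _ _ _ xy xz) ->.
have col0 x y : x != y -> [set x; y] \in N -> col [set x; y] = 0%N.
  by move=> xy /(phi_sum _ _ xy) E; rewrite colE // E modnn modnMl; case: ifP.
exists col; split=> //.
  (* Through a point of an edge of colour 0 passes an edge of [N], also of colour 0, and properness
     identifies the two. *)
  move=> e eE; apply/eqP/idP => [ce|eN].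
    have /card_gt0P[x xe] : (0 < #|e|)%N by move: eE; rewrite inE => /eqP->.
    have [y yx fN] := perfect_matchingP x pN.
    rewrite (proper e [set x; y] x) ?set21 //.
      by rewrite inE cards2 [x == y]eq_sym yx.
    by rewrite ce col0 // eq_sym.
  have /card_gt0P[x xe] : (0 < #|e|)%N by move: eE; rewrite inE => /eqP->.
  by have [y xy Ee] := edgeP _ _ eE xe; rewrite Ee col0 // -Ee.
(* The 2t - 1 edges at x have distinct colours, so they show all colours. *)
move=> x c cn; pose g y : 'I_n := Ordinal (col_lt [set x; y]).
have g_inj : {in [set~ x] &, injective g}.
  move=> y z; rewrite !inE => yx zx /(congr1 val) /= E.
  by apply: (@col_inj x); rewrite 1?eq_sym.
have : g @: [set~ x] == setT.
  rewrite eqEcard subsetT /= cardsT card_ord (card_in_imset g_inj).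
  by rewrite cardsC1 cT.
move=> /eqP/setP/(_ (Ordinal cn)); rewrite inE => /imsetP[y].
rewrite !inE => yx /(congr1 val) /= E; exists [set x; y].
by rewrite set21 inE cards2 [x == y]eq_sym yx.
Qed.

End OneFactorization.

(** * A configuration attaining the bound *)

Lemma maximum_fibres_exist (t : nat) (L R : finType)
    (ML : {set {set L}}) (MR : {set {set R}}) :
    (0 < t)%N -> #|L| = (2 * t)%N -> #|R| = (2 * t)%N ->
    perfect_matching ML -> perfect_matching MR ->
  let EL := edges L :\: ML in let ER := edges R :\: MR in
  exists2 A : {set {set L} * {set R}}, A \subset setX EL ER &
    fibres_perfect_matchings EL ER A.
Proof.
move=> t0 cL cR pL pR EL ER.
have [cl [cl_inj cl0 cl_lt cl_onto]] := one_factorization t0 cL pL.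
have [cr [cr_inj cr0 cr_lt cr_onto]] := one_factorization t0 cR pR.
(* The fibre over an edge is the whole colour class of its colour on the other side: colour 0 is the
   prescribed matching on both sides, so restricting to [EL] and [ER] removes nothing from a class
   of nonzero colour. *)
exists [set a in setX EL ER | cl a.1 == cr a.2].
  by apply/subsetP => a; rewrite inE => /andP[].
split=> [e eE|f fE]; apply/andP; split.
- apply/matchingP; split.
    by apply/subsetP => f; rewrite !inE /= => /andP[/andP[_ /andP[_ ->]]].
  move=> f f' y; rewrite !inE /= => /andP[/andP[_ /andP[_ fE]] /eqP cf].
  move=> /andP[/andP[_ /andP[_ fE']] /eqP cf'] yf yf'.
  by apply: (cr_inj f f' y) => //; rewrite ?inE // -cf -cf'.
- rewrite -subTset; apply/subsetP => y _; apply/bigcupP.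
  have [f [fE yf cf]] := cr_onto y (cl e) (cl_lt e).
  exists f => //; rewrite !inE /= cf eqxx andbT; move: (eE); rewrite !inE => /andP[eN eE'].
  rewrite eN eE' -cr0 // cf cl0 ?inE // eN /=.
  by move: fE; rewrite inE.
- apply/matchingP; split.
    by apply/subsetP => e; rewrite !inE /= => /andP[/andP[/andP[_ ->]]].
  move=> e e' y; rewrite !inE /= => /andP[/andP[/andP[_ eE] _] /eqP ce].
  move=> /andP[/andP[/andP[_ eE'] _] /eqP ce'] ye ye'.
  by apply: (cl_inj e e' y) => //; rewrite ?inE // ce ce'.
rewrite -subTset; apply/subsetP => y _; apply/bigcupP.
have [e [eE ye ce]] := cl_onto y (cr f) (cr_lt f).
exists e => //; rewrite !inE /= ce eqxx andbT; move: (fE); rewrite !inE => /andP[fN fE'].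
rewrite fN fE' -cl0 // ce cr0 ?inE // fN /= andbT.
by move: eE; rewrite inE.
Qed.

(** * The partner map and the paired Hadamard map *)

Definition mate (T : finType) (M : {set {set T}}) (i : T) : T :=
  odflt i [pick j | (j != i) && ([set i; j] \in M)].

Section Hadamard.
Local Open Scope ring_scope.
Variables (K : realType) (T : finType) (M : {set {set T}}) (F : {set T}).
Hypotheses (pM : perfect_matching M) (firstF : first_coordinates M F).
Implicit Types (x y : {ffun T -> K}) (i j : T).

Local Notation H := (paired_hadamard M F).
Local Notation sg i := (if i \in F then 1 else -1 : K).

(** Perfectness supplies a partner for every coordinate, so the default value in [mate] never
    occurs. *)
Lemma mate_spec i : mate M i != i /\ [set i; mate M i] \in M.
Proof.
rewrite /mate; case: pickP => [j /andP[]|] //.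
by have [j ji jM] := perfect_matchingP i pM => /(_ j); rewrite ji jM.
Qed.

Lemma same_pair i j :
  [exists p in M, (i \in p) && (j \in p)] = (j == i) || (j == mate M i).
Proof.
have [_ pi] := mate_spec i; have /andP[/matchingP[_ tM] _] := pM.
apply/exists_inP/idP => [[p pp /andP[ip jp]]|jp].
  by move: jp; rewrite (tM p [set i; mate M i] i) ?set21 // !inE.
by exists [set i; mate M i]; rewrite // set21 !inE.
Qed.

Lemma mateK : involutive (mate M).
Proof.
move=> i; have [ni pi] := mate_spec i; have [nmi pmi] := mate_spec (mate M i).
have := same_pair (mate M i) i; rewrite [i == mate M i]eq_sym (negbTE ni) /=.
move=> E; apply/esym/eqP; rewrite -E; apply/exists_inP.
by exists [set i; mate M i]; rewrite // set21 set22.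
Qed.

Lemma mate_first i : (mate M i \in F) = (i \notin F).
Proof.
have [ni pi] := mate_spec i; have /eqP/cards1P[k /setP E] := firstF pi.
move: (E i) (E (mate M i)); rewrite !inE eqxx eqxx orbT /= => -> ->.
have := E k; rewrite !inE eqxx => /andP[/orP[]/eqP-> _]; rewrite ?eqxx //.
  by rewrite (negbTE ni).
by rewrite eq_sym ni.
Qed.

(** The off-diagonal coefficient is 1 because one of the two partners is first; only the diagonal
    one can be -1. *)
Lemma paired_hadamardE x i : H x i = sg i * x i + x (mate M i).
Proof.
rewrite ffunE (eq_bigl _ _ (same_pair i)) (bigD1 i) ?eqxx //= orbb; congr (_ + _).
rewrite (big_pred1 (mate M i)) => [|j].
  by rewrite mate_first orbN mul1r.
have [ni _] := mate_spec i; rewrite /=.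
by case: eqVneq => [->|] //=; rewrite ?andbT // eq_sym (negbTE ni).
Qed.

Lemma paired_hadamardK x i : H (H x) i = 2 * x i.
Proof.
rewrite !paired_hadamardE mateK mate_first.
by case: (i \in F) => /=; ring.
Qed.

Lemma paired_hadamard_inj : injective (H : {ffun T -> K} -> _).
Proof.
move=> x y E; apply/ffunP => i; apply: (@mulfI _ 2); first by rewrite pnatr_eq0.
by rewrite -!paired_hadamardK E.
Qed.

(** After expansion, the own-coordinate and the partner-coordinate products each sum to [dotp x y],
    while the cross terms change sign under the partner map and cancel. *)
Lemma dotp_paired_hadamard x y : dotp (H x) (H y) = 2 * dotp x y.
Proof.
have mate_inj : injective (mate M) := inv_inj mateK.
have cross : \sum_i sg i * (x i * y (mate M i) + x (mate M i) * y i) = 0.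
  set s := \sum_i _; suff: s = - s by move/eqP; rewrite -addr_eq0 -mulr2n mulrn_eq0 => /eqP.
  rewrite {1}/s (reindex_inj mate_inj) -sumrN; apply: eq_bigr => i _ /=.
  by rewrite mateK mate_first; case: (i \in F) => /=; ring.
have mated : \sum_i x (mate M i) * y (mate M i) = dotp x y.
  by rewrite /dotp [RHS](reindex_inj mate_inj).
rewrite mulr_natl mulr2n -{2}mated -[RHS]addr0 -[X in _ = _ + X]cross /dotp.
rewrite -!big_split /=.
by apply: eq_bigr => i _; rewrite !paired_hadamardE; case: (i \in F); ring.
Qed.

End Hadamard.

(** * Inner products and parametrization of sign patterns *)

Section SignPatterns.
Local Open Scope ring_scope.
Variables (K : realType) (T : finType).
Implicit Types (S P : {set T}) (x y : {ffun T -> K}).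

Lemma dotp_sign_le S S' x y : sign_pattern S x -> sign_pattern S' y ->
  dotp x y <= #|S :&: S'|%:R.
Proof.
move=> xS yS; rewrite -sum1_card natr_sum [leRHS]big_mkcond /=.
apply: ler_sum => i _; move: (xS i) (yS i); rewrite inE.
by case: (i \in S) => [[]|] ->; case: (i \in S') => [[]|] -> /=; lra.
Qed.

Lemma dotp_sign_same S x : sign_pattern S x -> dotp x x = #|S|%:R.
Proof.
move=> xS; rewrite -sum1_card natr_sum [RHS]big_mkcond /=.
by apply: eq_bigr => i _; move: (xS i); case: (i \in S) => [[]|] -> /=; ring.
Qed.

(** A coordinate where the patterns differ lies in [S] and contributes -1 instead of 1, a loss of
    2. *)
Lemma dotp_sign_neq S x y : sign_pattern S x -> sign_pattern S y -> x <> y ->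
  dotp x y <= #|S|%:R - 2.
Proof.
move=> xS yS /eqP xy; have [i xyi] : exists i, x i != y i.
  apply/existsP; apply: contraNT xy; rewrite negb_exists => /forallP E.
  by apply/eqP/ffunP => i; apply/eqP; have := E i; rewrite negbK.
rewrite -sum1_card natr_sum big_mkcond /= /dotp (bigD1 i) // [in leRHS](bigD1 i) //=.
rewrite addrAC; apply: lerD.
  move: (xS i) (yS i) xyi.
  by case: (i \in S) => [[]->[]->|-> ->]; rewrite ?eqxx //; lra.
apply: ler_sum => j _; move: (xS j) (yS j).
by case: (j \in S) => [[]->[]->|-> ->] /=; lra.
Qed.

(** The subsets [P] of [S], as sets of plus positions, index the sign patterns on [S]; [signs S S]
    is the all-plus pattern. *)
Definition signs S P : {ffun T -> K} :=
  [ffun i => if i \in P then 1 else if i \in S then -1 else 0].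

Let ne : (-1 == 1 :> K) = false.
Proof. by apply/negbTE; rewrite lt_eqF //; lra. Qed.

Lemma sign_pattern_signs S P : P \subset S -> sign_pattern S (signs S P).
Proof.
move=> /subsetP sP i; rewrite ffunE; have := sP i.
by case: (i \in P) => [->|_] //; [left|case: (i \in S); [right|]].
Qed.

Lemma sign_patternP S x : sign_pattern S x ->
  exists2 P : {set T}, P \subset S & x = signs S P.
Proof.
move=> xS; exists [set i | x i == 1].
  apply/subsetP => i; rewrite inE; have := xS i; case: (i \in S) => // ->.
  by rewrite eq_sym oner_eq0.
apply/ffunP => i; rewrite ffunE inE; have := xS i.
by case: (i \in S) => [[]|] ->; rewrite ?eqxx ?ne // eq_sym oner_eq0.
Qed.

Lemma signs_inj S S' P P' : P \subset S -> P' \subset S' ->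
  signs S P = signs S' P' -> S = S' /\ P = P'.
Proof.
have recover S0 P0 : P0 \subset S0 ->
    [set i | signs S0 P0 i != 0] = S0 /\ [set i | signs S0 P0 i == 1] = P0.
  move=> /subsetP sP; split; apply/setP => i; rewrite inE ffunE; have := sP i;
    case: (i \in P0) => [/(_ isT) Si|_]; rewrite ?Si ?eqxx ?oner_eq0 //;
    case: (i \in S0); rewrite ?oppr_eq0 ?oner_eq0 ?eqxx ?ne //.
  by rewrite eq_sym oner_eq0.
move=> /recover[ES EP] /recover[ES' EP'] E.
by split; [rewrite -ES E | rewrite -EP E].
Qed.

(** All-plus patterns attain the bound of [dotp_sign_le], which makes them the test vectors for
    compatibility. *)
Lemma dotp_indicator S S' : dotp (signs S S) (signs S' S') = #|S :&: S'|%:R.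
Proof.
rewrite -sum1_card natr_sum [RHS]big_mkcond /=.
apply: eq_bigr => i _; rewrite !ffunE inE.
by case: (i \in S); case: (i \in S'); rewrite /= ?mulr1 ?mul0r ?mulr0.
Qed.

End SignPatterns.

(** * Supports in the disjoint union and their intersections *)

Section Supports.
Variables (L R : finType) (ML : {set {set L}}) (MR : {set {set R}}).
Implicit Types a b : {set L} * {set R}.

Lemma inl_support a u : (inl u \in support_of a) = (u \in a.1).
Proof.
rewrite inE (mem_imset _ _ (@inl_inj L R)).
by case: imsetP => [[]|]; rewrite ?orbF.
Qed.

Lemma inr_support a v : (inr v \in support_of a) = (v \in a.2).
Proof.
rewrite inE (mem_imset _ _ (@inr_inj L R)).
by case: imsetP => [[]|].
Qed.

Lemma support_of_inj : injective (@support_of L R).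
Proof.
move=> [e f] [e' f'] E; congr pair; apply/setP => u.
  by rewrite -(inl_support (e, f)) E inl_support.
by rewrite -(inr_support (e, f)) E inr_support.
Qed.

Lemma support_ofI a b :
  support_of a :&: support_of b = support_of (a.1 :&: b.1, a.2 :&: b.2).
Proof.
apply/setP => -[u|v]; rewrite in_setI.
  by rewrite !inl_support /= inE.
by rewrite !inr_support /= inE.
Qed.

Lemma card_support_of a : #|support_of a| = (#|a.1| + #|a.2|)%N.
Proof.
rewrite /support_of cardsU !card_imset; try exact: inl_inj; try exact: inr_inj.
rewrite (_ : _ :&: _ = set0) ?cards0 ?subn0 //.
by apply/setP => i; rewrite !inE; apply/negP => /andP[/imsetP[u _ ->] /imsetP[]].
Qed.

Lemma coord_pairs_perfect_matching :
  perfect_matching ML -> perfect_matching MR ->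
  perfect_matching (coord_pairs ML MR).
Proof.
case/andP=> /matchingP[/subsetP sL tL] /eqP cL.
case/andP=> /matchingP[/subsetP sR tR] /eqP cR.
apply/andP; split.
  apply/matchingP; split.
    apply/subsetP => p; rewrite inE => /orP[]/imsetP[e eM ->]; rewrite inE card_imset.
    - by have := sL _ eM; rewrite inE.
    - exact: inl_inj.
    - by have := sR _ eM; rewrite inE.
    - exact: inr_inj.
  move=> p q i; rewrite !inE => /orP[]/imsetP[e eM ->] /orP[]/imsetP[e' e'M ->];
    move=> /imsetP[u ue ->] /imsetP[v ve'] // [uv]; move: ue; rewrite uv => ue.
    by rewrite (tL e e' v).
  by rewrite (tR e e' v).
rewrite -subTset; apply/subsetP => -[u|v] _; apply/bigcupP.
  have /bigcupP[e eM ue] : u \in cover ML by rewrite cL inE.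
  by exists (inl @: e); rewrite ?inE ?imset_f.
have /bigcupP[e eM ue] : v \in cover MR by rewrite cR inE.
by exists (inr @: e); rewrite ?inE ?imset_f ?orbT.
Qed.

(** A pair inside the support would be a two-element subset of one of its two edges, hence equal to
    that edge, but the edges are taken outside the prescribed matchings. *)
Lemma support_avoids_pairs a p :
  matching ML -> matching MR ->
  a \in setX (edges L :\: ML) (edges R :\: MR) ->
  p \in coord_pairs ML MR -> ~~ (p \subset support_of a).
Proof.
case/andP=> /subsetP sL _ /andP[/subsetP sR _].
rewrite !inE => /andP[/andP[a1 /eqP c1] /andP[a2 /eqP c2]].
case/orP=> /imsetP[e eM ->]; apply/negP => /subsetP sub.
  have sea : e \subset a.1.
    by apply/subsetP => u ue; rewrite -inl_support sub ?imset_f.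
  have /eqP E : e == a.1.
    by rewrite eqEcard sea c1; have := sL _ eM; rewrite inE => /eqP->.
  by rewrite -E eM in a1.
have sea : e \subset a.2.
  by apply/subsetP => u ue; rewrite -inr_support sub ?imset_f.
have /eqP E : e == a.2.
  by rewrite eqEcard sea c2; have := sR _ eM; rewrite inE => /eqP->.
by rewrite -E eM in a2.
Qed.

(** If both edges differ, each side contributes at most 1. A shared edge already contributes 2, so
    the bound then says that the other two edges, which lie in a common fibre, are disjoint. *)
Lemma fibres_matchingsP (EL : {set {set L}}) (ER : {set {set R}})
    (A : {set {set L} * {set R}}) :
  EL \subset edges L -> ER \subset edges R -> A \subset setX EL ER ->
  fibres_matchings EL ER A <->
  {in A &, forall a b, a != b -> (#|a.1 :&: b.1| + #|a.2 :&: b.2| <= 2)%N}.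
Proof.
move=> /subsetP sEL /subsetP sER /subsetP sA; split=> [[mR mL] a b|mA].
  move=> aA bA ab; have := sA _ aA; have := sA _ bA; rewrite !inE.
  move=> /andP[b1 b2] /andP[a1 a2].
  have disj (T : finType) (N : {set {set T}}) (e e' : {set T}) :
      matching N -> e \in N -> e' \in N -> e != e' -> #|e :&: e'| = 0%N.
    move=> /andP[_ /trivIsetP tN] eN e'N /(tN _ _ eN e'N).
    by rewrite -setI_eq0 => /eqP->; rewrite cards0.
  case: a b aA bA ab a1 a2 b1 b2 => [e f] [e' f'] /= aA bA.
  rewrite xpair_eqE negb_and.
  case: (eqVneq e e') bA => [<-|ee'] /= bA ff' eE fE e'E f'E.
    rewrite (disj _ _ _ _ (mR e eE) _ _ ff') ?inE //.
    by rewrite setIid; have := sEL _ eE; rewrite inE => /eqP->.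
  case: (eqVneq f f') ff' bA => [<- _ bA|ff' _ bA].
    rewrite (disj _ _ _ _ (mL f fE) _ _ ee') ?inE //.
    by rewrite setIid; have := sER _ fE; rewrite inE => /eqP->.
  by apply: (@leq_add _ _ 1 1); apply: edges_meet; rewrite ?sEL ?sER.
split=> [e eE|f fE]; apply/matchingP; split.
- apply/subsetP => f; rewrite inE => /sA; rewrite inE => /andP[_]; exact: sER.
- move=> f f' x; rewrite !inE => fA f'A xf xf'; apply/eqP; apply: contraT => ff'.
  have := mA _ _ fA f'A; rewrite xpair_eqE eqxx /= setIid => /(_ ff').
  have /eqP-> : #|e| == 2 by have := sEL _ eE; rewrite inE.
  have : (0 < #|f :&: f'|)%N by apply/card_gt0P; exists x; rewrite inE xf.
  by case: #|_|.
- apply/subsetP => e; rewrite inE => /sA; rewrite inE => /andP[/sEL].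
  by [].
move=> e e' x; rewrite !inE => eA e'A xe xe'; apply/eqP; apply: contraT => ee'.
have := mA _ _ eA e'A; rewrite xpair_eqE eqxx andbT /= setIid => /(_ ee').
have /eqP-> : #|f| == 2 by have := sER _ fE; rewrite inE.
have : (0 < #|e :&: e'|)%N by apply/card_gt0P; exists x; rewrite inE xe.
by rewrite addn2; case: #|_|.
Qed.

End Supports.

(** * Weight, compatibility and size of the code *)

Section Code.
Local Open Scope ring_scope.
Variables (K : realType) (L R : finType) (ML : {set {set L}}) (MR : {set {set R}}).
Variables (F : {set (L + R)%type}) (A : {set {set L} * {set R}}).
Hypotheses (pL : perfect_matching ML) (pR : perfect_matching MR).
Hypothesis firstF : first_coordinates (coord_pairs ML MR) F.
Hypothesis sA : A \subset setX (edges L :\: ML) (edges R :\: MR).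

Local Notation H := (@paired_hadamard K _ (coord_pairs ML MR) F).
Local Notation Q := (hadamard_code (K := K) ML MR F A).

Let pLR : perfect_matching (coord_pairs ML MR) :=
  coord_pairs_perfect_matching pL pR.

Lemma card_support_edges a : a \in A -> #|support_of a| = 4%N.
Proof.
move/(subsetP sA); rewrite !inE card_support_of.
by case/andP=> /andP[_ /eqP->] /andP[_ /eqP->].
Qed.

Lemma hadamard_code_weight : weight_eight_code Q.
Proof.
have mL : matching ML by case/andP: pL.
have mR : matching MR by case/andP: pR.
move=> _ [x [a aA xS] <-].
(* Partners never both lie in the support, so at most one of the two terms of [H x i] is nonzero. *)
have vals i : [\/ H x i = 0, H x i = 1 | H x i = -1].
  rewrite paired_hadamardE //; set j := mate _ i.
  have : ~~ ([set i; j] \subset support_of a).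
    by apply: (support_avoids_pairs mL mR (subsetP sA _ aA)); have [] := mate_spec pLR i.
  rewrite subUset !sub1set; move: (xS i) (xS j).
  by case: (_ \in _) => [[]|] ->; case: (j \in _) => [[]|] -> //= _;
    case: (_ \in _); rewrite ?mulr0 ?mulr1 ?mul1r ?addr0 ?add0r ?mulrNN ?mulr1
      ?mulrN1 ?opprK; by [constructor 1|constructor 2|constructor 3].
(* As all entries are 0, 1 or -1, the weight equals the squared norm, which is [2 * 4 = 8]. *)
split=> //; apply/eqP; rewrite -(eqr_nat K) -sum1_card natr_sum big_mkcond /=.
have <- : dotp (H x) (H x) = 8.
  by rewrite dotp_paired_hadamard // (dotp_sign_same xS) card_support_edges // -natrM.
apply/eqP; apply: eq_bigr => i _; rewrite inE.
by case: (vals i) => ->; rewrite ?eqxx ?oppr_eq0 ?oner_eq0 /= ?mulrNN ?mulr0 ?mulr1.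
Qed.

Lemma hadamard_code_compatible :
  internally_compatible Q <->
  {in A &, forall a b, a != b -> (#|a.1 :&: b.1| + #|a.2 :&: b.2| <= 2)%N}.
Proof.
split=> [cQ a b aA bA ab|mA _ _ [x [a aA xS] <-] [y [b bA yS] <-] neq]; last first.
  have xy : x <> y by move=> E; apply: neq; rewrite E.
  rewrite dotp_paired_hadamard //; suff : dotp x y <= 2 by lra.
  case: (eqVneq a b) => [Eab|ab].
    rewrite -Eab in yS; have := dotp_sign_neq xS yS xy.
    by rewrite card_support_edges //; lra.
  apply: le_trans (dotp_sign_le xS yS) _.
  by rewrite support_ofI card_support_of ler_nat mA.
(* For all-plus patterns the inner product after [H] is twice the size of the intersection, so the
   bound 4 leaves at most 2 common points. *)
pose x c : {ffun (L + R)%type -> K} := signs K (support_of c) (support_of c).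
have Qx c : c \in A -> Q (H (x c)).
  by move=> cA; exists (x c) => //; exists c => //; apply: sign_pattern_signs.
have neq : H (x a) <> H (x b).
  move=> /(paired_hadamard_inj pLR firstF) /signs_inj[//|//|/support_of_inj E _].
  by rewrite E eqxx in ab.
have := cQ _ _ (Qx _ aA) (Qx _ bA) neq.
rewrite dotp_paired_hadamard // dotp_indicator support_ofI card_support_of /=.
by rewrite -natrM ler_nat; lia.
Qed.

(** Vectors correspond to a support in [A] with a set of plus positions, $2^4$ choices per support;
    injectivity of [H] and of [signs] rules out coincidences. *)
Lemma hadamard_code_card : (Q #= `I_(16 * #|A|))%card.
Proof.
pose D := [set d : ({set L} * {set R}) * {set (L + R)%type} |
  (d.1 \in A) && (d.2 \subset support_of d.1)].
have cD : #|D| = (16 * #|A|)%N.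
  rewrite mulnC -sum_nat_const -sum1_card (partition_big fst (mem A)) /=; last first.
    by move=> d; rewrite inE => /andP[].
  apply: eq_bigr => a aA; rewrite (_ : 16%N = (2 ^ 4)%N) //.
  rewrite -(card_support_edges aA) -card_powerset.
  rewrite -sum1_card (reindex_onto (fun P => (a, P)) snd) /=; last first.
    by case=> b P /andP[_ /eqP /= ->].
  by apply: eq_bigl => P; rewrite !inE aA !eqxx !andbT.
pose g (d : ({set L} * {set R}) * {set (L + R)%type}) : {ffun (L + R)%type -> K} :=
  H (signs K (support_of d.1) d.2).
pose h (i : 'I_#|D|) := g (enum_val i).
have -> : Q = (h @` [set: 'I_#|D|])%classic.
  apply/seteqP; split=> [_ [x [a aA xS] <-]|_ [i _ <-]].
    have [P sP ->] := sign_patternP xS.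
    have dD : (a, P) \in D by rewrite inE aA.
    by exists (enum_rank_in dD (a, P)); rewrite // /h enum_rankK_in.
  have := enum_valP i; rewrite inE => /andP[aA sP].
  exists (signs K (support_of (enum_val i).1) (enum_val i).2) => //.
  by exists (enum_val i).1 => //; apply: sign_pattern_signs.
have h_inj : injective h.
  move=> i j /(paired_hadamard_inj pLR firstF) /signs_inj E; apply: enum_val_inj.
  have := enum_valP i; have := enum_valP j; rewrite !inE => /andP[_ sj] /andP[_ si].
  have [/support_of_inj E1 E2] := E si sj.
  by move: E1 E2; case: (enum_val i) (enum_val j) => [? ?] [? ?] /= -> ->.
rewrite -cD (card_eql (inj_card_eq _)); last by move=> i j _ _ /h_inj.
by rewrite card_eq_sym card_II.
Qed.

End Code.

(** * Criterion, bounds, equality case and the code in twelve coordinates *)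

Theorem proposition6p4 (K : realType) (t : nat) (L R : finType)
    (ML : {set {set L}}) (MR : {set {set R}}) (F : {set (L + R)%type}) :
  (2 <= t)%N -> #|L| = (2 * t)%N -> #|R| = (2 * t)%N ->
  perfect_matching ML -> perfect_matching MR ->
  first_coordinates (coord_pairs ML MR) F ->
  let EL := (edges L :\: ML)%SET in
  let ER := (edges R :\: MR)%SET in
  let Q := hadamard_code (K := K) ML MR F in
  [/\ forall A : {set {set L} * {set R}}, A \subset finset.setX EL ER ->
        (weight_eight_code (Q A) /\ internally_compatible (Q A) <->
         fibres_matchings EL ER A) /\
        (fibres_matchings EL ER A ->
         [/\ (#|A| <= 2 * t ^ 2 * (t - 1))%N,
             (Q A #<= `I_(32 * t ^ 2 * (t - 1)))%card,
             #|A| = (2 * t ^ 2 * (t - 1))%N <->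
               fibres_perfect_matchings EL ER A
           & (Q A #= `I_(32 * t ^ 2 * (t - 1)))%card <->
               fibres_perfect_matchings EL ER A]),
      exists A : {set {set L} * {set R}},
        [/\ A \subset finset.setX EL ER, fibres_matchings EL ER A,
            #|A| = (2 * t ^ 2 * (t - 1))%N
          & (Q A #= `I_(32 * t ^ 2 * (t - 1)))%card]
    & t = 3 ->
        #|{: L + R}| = 12 /\
        exists A : {set {set L} * {set R}},
          [/\ A \subset finset.setX EL ER,
              weight_eight_code (Q A), internally_compatible (Q A)
            & (Q A #= `I_576)%card]].
Proof.
move=> t2 cL cR pL pR firstF EL ER Q.
have cEL := card_edges_perfect_matching cL pL.
have cER := card_edges_perfect_matching cR pR.
have compat (A : {set {set L} * {set R}}) : A \subset setX EL ER ->
    internally_compatible (Q A) <-> fibres_matchings EL ER A.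
  move=> sA; rewrite fibres_matchingsP ?subsetDl //.
  exact: hadamard_code_compatible.
(* Each support yields 16 vectors, so equality for the code reduces to equality for [#|A|]. *)
have cQ (A : {set {set L} * {set R}}) m : A \subset setX EL ER ->
    (Q A #= `I_(16 * m))%card <-> #|A| = m.
  move=> sA; rewrite (card_eql (hadamard_code_card K pL pR firstF sA)).
  by split=> [/card_eq_II|->]; [lia|exact: card_eqxx].
have E32 : (32 * t ^ 2 * (t - 1) = 16 * (2 * t ^ 2 * (t - 1)))%N by lia.
have [A0 sA0 perfA0] := maximum_fibres_exist (ltnW t2) cL cR pL pR.
have matchA0 : fibres_matchings EL ER A0.
  by case: perfA0 => [pr pl]; split=> e; [move=> /pr|move=> /pl]; case/andP.
have [_ [_ /(_ perfA0) cA0]] := fibres_matchings_card cL cR cEL cER sA0 matchA0.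
split.
- move=> A sA; split.
    split=> [[_ /(compat _ sA)] //|/(compat _ sA) cA]; split=> //.
    exact: hadamard_code_weight.
  move=> mA; have [leA eqA] := fibres_matchings_card cL cR cEL cER sA mA.
  split=> //; rewrite E32; last by rewrite cQ.
  rewrite (card_le_eql (hadamard_code_card K pL pR firstF sA)) card_le_II.
  by rewrite leq_pmul2l.
- by exists A0; split=> //; rewrite E32 cQ.
move=> t3; split; first by rewrite card_sum cL cR t3.
exists A0; split=> //; first exact: hadamard_code_weight.
  exact/compat.
(* For [t = 3] the maximum is [2 * 9 * 2 = 36] supports. *)
have -> : 576 = (16 * (2 * t ^ 2 * (t - 1)))%N by rewrite t3.
exact/cQ.
Qed.
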